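(* Let $A$ be an infinite von Neumann algebra, meaning that there is a sequence $(p_n)_{n\in\mathbb{N}}$ of pairwise orthogonal projections in $A$, each Murray--von Neumann equivalent in $A$ to the identity $1$, with $1=\sum_n p_n$ (convergence in the strong operator topology). Then the cyclic cohomology of $A$ vanishes, i.e. $H^n_\lambda(A)=0$ for all $n\ge 0$.
   Context: Cyclic cohomology is taken in the purely algebraic sense of Connes. For a unital $\mathbb{C}$-algebra $A$ and $n\ge 0$, let $C^n_\lambda(A)$ be the space of $(n+1)$-linear functionals $\varphi:A^{n+1}\to\mathbb{C}$ (no continuity required) satisfying $\varphi(a_1,\dots,a_n,a_0)=(-1)^n\varphi(a_0,a_1,\dots,a_n)$ for all $a_0,\dots,a_n\in A$. The Hochschild coboundary $b:C^n_\lambda(A)\to C^{n+1}_\lambda(A)$ is $$(b\varphi)(a_0,\dots,a_{n+1})=\sum_{j=0}^{n}(-1)^j\varphi(a_0,\dots,a_ja_{j+1},\dots,a_{n+1})+(-1)^{n+1}\varphi(a_{n+1}a_0,a_1,\dots,a_n).$$ Then $b^2=0$, and $H^n_\lambda(A)$ denotes the $n$-th cohomology group of the complex $(C^\bullet_\lambda(A),b)$, $n\ge0$. In particular $H^0_\lambda(A)$ is the space of linear functionals $\tau$ on $A$ with $\tau(ab)=\tau(ba)$. A projection $p\in A$ is Murray--von Neumann equivalent to $1$ if there is $v\in A$ with $v^*v=1$ and $vv^*=p$. *)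

(* Defs.v *)
From HB Require Import structures.
From mathcomp Require Import all_boot all_order all_algebra.
From mathcomp Require Import all_classical all_reals all_analysis.
From mathcomp Require Import complex.

Set Implicit Arguments.
Unset Strict Implicit.
Unset Printing Implicit Defensive.

Import Order.TTheory GRing.Theory Num.Theory.
Import numFieldNormedType.Exports.
Import Quotient.

Local Open Scope classical_set_scope.
Local Open Scope ring_scope.
Local Open Scope quotient_scope.
Local Open Scope complex_scope.

(* The algebra is a module [A] with its product [mul]: [algType] would force
   [1 != 0] and so exclude the zero algebra. *)
Section CyclicCohomology.
Variables (K : comNzRingType) (A : lmodType K) (mul : A -> A -> A).

Definition cochain (n : nat) : Type := ('I_n.+1 -> A) -> K.
HB.instance Definition _ n := GRing.Zmodule.on (cochain n).

Definition multilinear n (phi : cochain n) : Prop :=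
  forall (i : 'I_n.+1) (a : 'I_n.+1 -> A) (k : K) (x y : A),
    phi (dfwith a i (k *: x + y)) =
    k * phi (dfwith a i x) + phi (dfwith a i y).

Definition cyclic_cochain n : {pred cochain n} := fun phi =>
  `[< multilinear phi /\
      forall a, phi (fun i => a (ordS i)) = (-1) ^+ n * phi a >].

(* [lift ord_max i] and [lift ord0 i] are [i] and [i + 1] in ['I_n.+2]. *)
Definition face n (a : 'I_n.+2 -> A) (j : 'I_n.+1) : 'I_n.+1 -> A := fun i =>
  if (i < j)%N then a (lift ord_max i)
  else if i == j then mul (a (lift ord_max i)) (a (lift ord0 i))
  else a (lift ord0 i).

Definition last_face n (a : 'I_n.+2 -> A) : 'I_n.+1 -> A := fun i =>
  if i == ord0 then mul (a ord_max) (a ord0) else a (lift ord_max i).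

Definition hochschild n (phi : cochain n) : cochain n.+1 := fun a =>
  \sum_(j < n.+1) (-1) ^+ j * phi (face a j)
  + (-1) ^+ n.+1 * phi (last_face a).

Definition cyclic_cocycle n : {pred cochain n} := fun phi =>
  (phi \in @cyclic_cochain n) && `[< hochschild phi = 0 >].

Lemma cochain0E n a : (0 : cochain n) a = 0.
Proof. by []. Qed.

Lemma cochainBE n (f g : cochain n) a : (f - g) a = f a - g a.
Proof. by []. Qed.

Lemma cyclic_cochain_zmod_closed n : zmod_closed (@cyclic_cochain n).
Proof.
split.
  by apply/asboolP; split=> [i a k x y|a]; rewrite !cochain0E ?mulr0 ?addr0.
move=> f g /asboolP[fl fc] /asboolP[gl gc]; apply/asboolP; split.
  by move=> i a k x y; rewrite !cochainBE fl gl mulrBr opprD addrACA.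
by move=> a; rewrite !cochainBE fc gc mulrBr.
Qed.

Lemma hochschildB n : {morph @hochschild n : f g / f - g}.
Proof.
move=> f g; apply/funext => a; rewrite !cochainBE /hochschild.
under eq_bigr do rewrite cochainBE mulrBr.
by rewrite sumrB cochainBE mulrBr opprD addrACA.
Qed.

Lemma cyclic_cocycle_zmod_closed n : zmod_closed (@cyclic_cocycle n).
Proof.
have [C0 CB] := cyclic_cochain_zmod_closed n.
have h0 : hochschild (0 : cochain n) = 0.
  by rewrite -(subrr (0 : cochain n)) hochschildB subrr.
split; first by apply/andP; split=> //; apply/asboolP.
move=> f g /andP[fC /asboolP fb] /andP[gC /asboolP gb].
apply/andP; split; first exact: CB.
by apply/asboolP; rewrite hochschildB fb gb subrr.
Qed.

HB.instance Definition _ n :=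
  GRing.isZmodClosed.Build (cochain n) (@cyclic_cocycle n)
    (cyclic_cocycle_zmod_closed n).

Record cocycle n := Cocycle {
  cocycle_val :> cochain n; cocycleP : cocycle_val \in @cyclic_cocycle n }.
HB.instance Definition _ n := [isSub for @cocycle_val n].
HB.instance Definition _ n := [Choice of cocycle n by <:].
HB.instance Definition _ n := [SubChoice_isSubZmodule of cocycle n by <:].

(* The complex starts in degree 0. *)
Definition cyclic_coboundary n : {pred cocycle n} :=
  match n with
  | 0 => fun phi => phi == 0
  | m.+1 => fun phi => `[< exists2 psi : cochain m,
      psi \in @cyclic_cochain m & val phi = hochschild psi >]
  end.

Lemma cyclic_coboundary_zmod_closed n : zmod_closed (@cyclic_coboundary n).
Proof.
case: n => [|n]; split.
- exact: eqxx.
- by move=> f g /eqP -> /eqP ->; rewrite subrr; exact: eqxx.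
- apply/asboolP; exists 0; first by case: (cyclic_cochain_zmod_closed n).
  by rewrite -(subrr (0 : cochain n)) hochschildB subrr.
move=> f g /asboolP[f' f'C fE] /asboolP[g' g'C gE]; apply/asboolP.
exists (f' - g'); first by case: (cyclic_cochain_zmod_closed n) => _; apply.
by rewrite hochschildB -fE -gE.
Qed.

HB.instance Definition _ n :=
  GRing.isZmodClosed.Build (cocycle n) (@cyclic_coboundary n)
    (cyclic_coboundary_zmod_closed n).

Definition cyclic_cohomology n : zmodType := {quot @cyclic_coboundary n}.

End CyclicCohomology.

Section VonNeumann.
Variables (R : realType) (H : completeNormedModType R[i]).
Variable dot : {dot H for Num.conj}.

Definition bounded_operator (f : H -> H) : Prop :=
  linear f /\ exists M : R[i], forall x, `|f x| <= M * `|x|.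

Definition is_adjoint (f g : H -> H) : Prop :=
  forall x y, dot (f x) y = dot x (g y).

(* A von Neumann algebra on [H]: a unital *-subalgebra of B(H), closed in B(H)
   for the strong operator topology, i.e. the topology of pointwise
   convergence. [vn_adjoint] says that the adjoint of [f], which is unique
   and whose existence in B(H) is Riesz's theorem, lies in the algebra. *)
Record vonNeumannAlgebra := VonNeumannAlgebra {
  vn_set :> set (H -> H);
  vn_bounded : forall f, vn_set f -> bounded_operator f;
  vn_id : vn_set idfun;
  vn_linear : forall (k : R[i]) f g, vn_set f -> vn_set g ->
    vn_set (k *: f + g);
  vn_comp : forall f g, vn_set f -> vn_set g -> vn_set (f \o g);
  vn_adjoint : forall f, vn_set f -> exists g, vn_set g /\ is_adjoint f g;
  vn_closed : forall f, bounded_operator f ->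
    closure (vn_set : set {ptws H -> H}) f -> vn_set f }.

Variable A : vonNeumannAlgebra.

Definition vn_pred : {pred H -> H} := fun f => `[< vn_set A f >].

Record vn_elt := VnElt { vn_val :> H -> H; vn_valP : vn_val \in vn_pred }.

Lemma vn_submod_closed : submod_closed vn_pred.
Proof.
split=> [|k f g /asboolP Af /asboolP Ag]; apply/asboolP; last exact: vn_linear.
by have := vn_linear (-1) (vn_id A) (vn_id A); rewrite scaleN1r addNr.
Qed.

HB.instance Definition _ :=
  GRing.isSubmodClosed.Build R[i] (H -> H) vn_pred vn_submod_closed.
HB.instance Definition _ := [isSub for vn_val].
HB.instance Definition _ := [Choice of vn_elt by <:].
HB.instance Definition _ := [SubChoice_isSubLmodule of vn_elt by <:].

Lemma vn_comp_subproof (f g : vn_elt) : (f \o g) \in vn_pred.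
Proof.
apply/asboolP; apply: vn_comp; [exact/asboolP/vn_valP|exact/asboolP/vn_valP].
Qed.

Lemma vn_id_subproof : (idfun : H -> H) \in vn_pred.
Proof. by apply/asboolP; exact: vn_id. Qed.

Definition vn_mul (f g : vn_elt) : vn_elt := VnElt (vn_comp_subproof f g).
Definition vn_one : vn_elt := VnElt vn_id_subproof.

Lemma vn_eltB (f : vn_elt) : bounded_operator f.
Proof. by apply: (@vn_bounded A); exact/asboolP/vn_valP. Qed.

Lemma vn_mulA : associative vn_mul.
Proof. by move=> f g h; apply: val_inj. Qed.
Lemma vn_mul1r : left_id vn_one vn_mul.
Proof. by move=> f; apply: val_inj. Qed.
Lemma vn_mulr1 : right_id vn_one vn_mul.
Proof. by move=> f; apply: val_inj. Qed.
Lemma vn_mulDl : left_distributive vn_mul +%R.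
Proof. by move=> f g h; apply: val_inj. Qed.
Lemma vn_mulDr : right_distributive vn_mul +%R.
Proof.
move=> f g h; apply: val_inj; apply/funext => x /=.
by have [flin _] := vn_eltB f; have := flin 1 (g x) (h x); rewrite !scale1r.
Qed.

HB.instance Definition _ := GRing.Zmodule_isPzRing.Build vn_elt
  vn_mulA vn_mul1r vn_mulr1 vn_mulDl vn_mulDr.

Lemma vn_star_subproof (f : vn_elt) : exists g : vn_elt, is_adjoint f g.
Proof.
have /asboolP/vn_adjoint[g [Ag fg]] := vn_valP f.
by exists (VnElt (introT (asboolP _) Ag : g \in vn_pred)).
Qed.

Definition star (f : vn_elt) : vn_elt := projT1 (cid (vn_star_subproof f)).

Lemma starP (f : vn_elt) : is_adjoint f (star f).
Proof. by rewrite /star; case: cid. Qed.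

Definition projection (p : vn_elt) : Prop := p * p = p /\ star p = p.

Definition equivalent_to_one (p : vn_elt) : Prop :=
  exists v : vn_elt, star v * v = 1 /\ v * star v = p.

Definition infinite_vn : Prop :=
  exists p : nat -> vn_elt,
    [/\ forall n, projection (p n),
        forall m n, m != n -> p m * p n = 0,
        forall n, equivalent_to_one (p n)
      & {ptws, (fun N => vn_val (\sum_(n < N) p n)) @ \oo --> (idfun : H -> H)}].

Definition vn_cyclic_cohomology (n : nat) : zmodType :=
  @cyclic_cohomology R[i] vn_elt *%R n.

End VonNeumann.

(* Main.v *)
Require Import Defs.
From HB Require Import structures.
From mathcomp Require Import all_boot all_order all_algebra.
From mathcomp Require Import all_classical all_reals all_analysis.
From mathcomp Require Import complex.
From mathcomp Require Import zify ring.

(** Proof idea. Choose isometries v_i in A with orthogonal ranges whose range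
    projections sum to 1. For w_i in A, uniformly bounded and with orthogonal
    ranges, the series sum_i w_i v_i^* converges strongly to an element of A; this
    gives the endomorphism rho(a) = sum_i v_i a v_i^* and the isometry
    s = sum_i v_(i+1) v_i^*, with v_0 v_0^* + s s^* = 1, rho(a) v_0 = v_0 a and
    rho(a) s = s rho(a). Hence rho is equivalent to id + rho, and an Eilenberg
    swindle, made explicit by a simplicial homotopy, contracts the Hochschild
    complex.

    For a cyclic cocycle f, write f = b g. Then (1 - t) g is closed for the
    acyclic bar differential b', so (1 - t) g = b' h, and N h is a cyclic cocycle
    two degrees lower. By induction it is a coboundary; correcting h by a
    b'-boundary makes N h = 0, hence h = (1 - t) k, and g - b k is a cyclic
    cochain with b (g - b k) = f. *)

Set Implicit Arguments.
Unset Strict Implicit.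
Unset Printing Implicit Defensive.

Import Order.TTheory GRing.Theory Num.Theory.
Import numFieldNormedType.Exports.
Local Open Scope ring_scope.
Local Open Scope complex_scope.

(** Equalities of reindexed sequences are settled entry by entry: [slots] splits on every index
    comparison, [congr_lia] matches the remaining indices by arithmetic. *)
Ltac congr_lia := solve [done | lia | progress f_equal; congr_lia].
Ltac slots := repeat (case: ifP => ? //=; try (exfalso; lia)).
Ltac by_slots := slots; congr_lia.

(** * Cancellation in alternating double sums *)

Section AlternatingSums.
Variable K : comPzRingType.

(** The term at (i, j) with i < j cancels the one at (j - 1, i), which has the opposite sign. The
    induction peels off the last row and the last column. *)
Lemma alt_sum_faces (G : nat -> nat -> K) n :
    (forall i j, (i < j <= n.+1)%N -> G i j = G j.-1 i) ->
  \sum_(j < n.+2) \sum_(i < n.+1) (-1) ^+ (i + j) * G i j = 0.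
Proof.
elim: n => [|n IH] GE.
  rewrite !big_ord_recl !big_ord0 /= (GE 0%N 1%N) //=; ring.
rewrite big_ord_recr /=.
under eq_bigr => j _ do rewrite big_ord_recr /=.
rewrite big_split /= IH => [|i j ij]; last by apply: GE; lia.
rewrite add0r -big_split big1 // => i _ /=.
rewrite (GE i n.+2) /=; last by have := ltn_ord i; lia.
by rewrite !addnS !addSn !exprS addnC; ring.
Qed.

(** Terms of [G] below the diagonal cancel the [F] terms at (i - 1, j), those with j > i + 1 cancel
    the [F] terms at (i, j - 1). The rest, at (i, i) and (i, i + 1), telescopes to its two ends. *)
Lemma alt_sum_homotopy (G F : nat -> nat -> K) n :
    (forall i j, (j < i <= n)%N -> G i j = F i.-1 j) ->
    (forall i j, (i.+1 < j <= n.+1)%N -> G i j = F i j.-1) ->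
    (forall i, (0 < i <= n)%N -> G i i = G i.-1 i) ->
  \sum_(i < n.+1) \sum_(j < n.+2) (-1) ^+ (i + j) * G i j
  + \sum_(i < n) \sum_(j < n.+1) (-1) ^+ (i + j) * F i j
  = G 0%N 0%N - G n n.+1.
Proof.
elim: n => [|n IH] Glt Ggt Geq.
  rewrite big_ord0 !big_ord_recl !big_ord0 /=; ring.
rewrite big_ord_recr [X in _ + X]big_ord_recr /=.
under eq_bigr => i _ do rewrite big_ord_recr /=.
rewrite big_split /=.
under [X in _ + (X + _)]eq_bigr => i _ do rewrite big_ord_recr /=.
rewrite [X in _ + (X + _)]big_split /=.
set S1 := \sum_(i < n.+1) \sum_(j < n.+2) _.
set S2 := \sum_(i < n) \sum_(j < n.+1) _.
have {IH} <- /=: S1 + S2 + G n n.+1 = G 0%N 0%N.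
  rewrite IH ?subrK // => [i j ij|i j ij|i ij]; [apply: Glt|apply: Ggt|apply: Geq]; lia.
rewrite [\sum_(j < n.+3) _]big_ord_recr [\sum_(j < n.+2) _]big_ord_recr /=.
rewrite [\sum_(j < n.+2) _]big_ord_recr [\sum_(i < n.+1) _]big_ord_recr /=.
set T1 := \sum_(j < n.+1) _; set T2 := \sum_(j < n.+1) _.
set T3 := \sum_(i < n) _; set T4 := \sum_(i < n) _.
have -> : T1 = - T2.
  rewrite /T1 /T2 -sumrN; apply: eq_bigr => j _.
  by rewrite Glt /=; [rewrite addSn exprS; ring|have := ltn_ord j; lia].
have -> : T3 = - T4.
  rewrite /T3 /T4 -sumrN; apply: eq_bigr => i _.
  by rewrite Ggt /=; [rewrite !addnS !exprS; ring|have := ltn_ord i; lia].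
rewrite (Ggt n n.+2) ?(Geq n.+1) /=; [|lia|lia].
rewrite !addnS !addSn !exprS addnn -signr_odd odd_double /=; ring.
Qed.

End AlternatingSums.

(** * Hochschild, bar and cyclic operators on functions of sequences *)

Section SequenceCochains.
Variables (K : numFieldType) (A : lmodType K) (mul : A -> A -> A) (one : A).
Local Notation V := ((nat -> A) -> K^o).
Implicit Types (a : nat -> A) (f g : V).

(* A cochain of degree [n] is a function of infinite sequences, meant to read the
   entries [0..n] only. [sface n] and [srot n] act on the first [n + 2] and
   [n + 1] entries and shift or fix the others, so that the simplicial and cyclic
   identities hold for whole sequences; [sface n n.+1] is the wrap-around face. *)
Definition sface n j a : nat -> A := fun i =>
  if (j <= n)%N then
    if (i < j)%N then a i else if i == j then mul (a i) (a i.+1) else a i.+1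
  else if i == 0 then mul (a n.+1) (a 0)
  else if (i <= n)%N then a i else a i.+1.

Definition srot n a : nat -> A := fun i =>
  if i == 0 then a n else if (i <= n)%N then a i.-1 else a i.

Definition coface n j f : V := fun a => (-1) ^+ j * f (sface n j a).
Definition cyc n f : V := fun a => (-1) ^+ n * f (srot n a).
Definition hoch n f : V := \sum_(j < n.+2) coface n j f.
Definition bar n f : V := \sum_(j < n.+1) coface n j f.
Definition cnorm n f : V := \sum_(i < n.+1) iter i (cyc n) f.

Lemma coface_is_linear n j : linear (coface n j).
Proof. by move=> k f g; apply/funext => a; rewrite /coface !fctE /GRing.scale /=; ring. Qed.
HB.instance Definition _ n j :=
  GRing.isLinear.Build K V V *:%R (coface n j) (coface_is_linear n j).

Lemma cyc_is_linear n : linear (cyc n).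
Proof. by move=> k f g; apply/funext => a; rewrite /cyc !fctE /GRing.scale /=; ring. Qed.
HB.instance Definition _ n :=
  GRing.isLinear.Build K V V *:%R (cyc n) (cyc_is_linear n).

Lemma hoch_is_linear n : linear (hoch n).
Proof.
move=> k f g; rewrite /hoch scaler_sumr -big_split.
by apply: eq_bigr => j _; rewrite linearP.
Qed.
HB.instance Definition _ n :=
  GRing.isLinear.Build K V V *:%R (hoch n) (hoch_is_linear n).

Lemma bar_is_linear n : linear (bar n).
Proof.
move=> k f g; rewrite /bar scaler_sumr -big_split.
by apply: eq_bigr => j _; rewrite linearP.
Qed.
HB.instance Definition _ n :=
  GRing.isLinear.Build K V V *:%R (bar n) (bar_is_linear n).

Lemma iter_cyc_is_linear n i : linear (iter i (cyc n)).
Proof. by elim: i => // i IH k f g; rewrite /= IH linearP. Qed.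
HB.instance Definition _ n i :=
  GRing.isLinear.Build K V V *:%R (iter i (cyc n)) (iter_cyc_is_linear n i).

Lemma cnorm_is_linear n : linear (cnorm n).
Proof.
move=> k f g; rewrite /cnorm scaler_sumr -big_split.
by apply: eq_bigr => j _; rewrite iter_cyc_is_linear.
Qed.
HB.instance Definition _ n :=
  GRing.isLinear.Build K V V *:%R (cnorm n) (cnorm_is_linear n).

Lemma hochE n f a : hoch n f a = \sum_(j < n.+2) (-1) ^+ j * f (sface n j a).
Proof. by rewrite /hoch fct_sumE. Qed.

Lemma barE n f a : bar n f a = \sum_(j < n.+1) (-1) ^+ j * f (sface n j a).
Proof. by rewrite /bar fct_sumE. Qed.

(** * Relations between the rotation, the cofaces and the norm operator *)

Lemma iter_srot n k a i : (k <= n.+1)%N -> iter k (srot n) a i =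
  if (i < k)%N then a (n.+1 - k + i)%N else if (i <= n)%N then a (i - k)%N else a i.
Proof.
elim: k i => [|k IH] i lekn /=; first by rewrite subn0; case: ifP.
rewrite /srot; case: eqP => [->|i0]; [|case: ifP => lin];
  rewrite IH ?(ltnW lekn) //;
  repeat case: ifP => ?; by [lia|congr a; lia].
Qed.

Lemma cyc_iterE n k f a :
  iter k (cyc n) f a = ((-1) ^+ n) ^+ k * f (iter k (srot n) a).
Proof.
elim: k a => [|k IH] a; first by rewrite mul1r.
by rewrite iterS /cyc IH mulrA -exprS -iterSr.
Qed.

(** The signs multiply to (-1)^(n (n + 1)) = 1. *)
Lemma cyc_order n f : iter n.+1 (cyc n) f = f.
Proof.
apply/funext => a; rewrite cyc_iterE -exprM -signr_odd oddM andbN mul1r.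
congr f; apply/funext => i; rewrite iter_srot // subnn add0n ltnS.
by case: ifP => // ->.
Qed.

(** With the signs built into both operators, the cyclic relation t e_(j+1) = e_j t carries no
    sign. *)
Lemma cyc_coface n j f : (j <= n)%N ->
  cyc n.+1 (coface n j.+1 f) = coface n j (cyc n f).
Proof.
move=> lejn; apply/funext => a; rewrite /cyc /coface.
have -> : sface n j.+1 (srot n.+1 a) = srot n (sface n j a).
  apply/funext => i; rewrite /sface /srot lejn.
  case: i => [|i]; repeat case: ifP => ? //=;
  by [lia|congr (a _); lia|congr (mul (a _) (a _)); lia].
by rewrite !exprS; ring.
Qed.

Lemma cyc_coface0 n f : cyc n.+1 (coface n 0 f) = coface n n.+1 f.
Proof.
apply/funext => a; rewrite /cyc /coface mul1r; congr (_ * f _).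
apply/funext => i; rewrite /sface /srot ltnn /=.
by case: i => [|i] //=.
Qed.

Lemma iter_cyc_coface n j f : (j <= n.+1)%N ->
  iter j (cyc n.+1) (coface n j f) = coface n 0 (iter j (cyc n) f).
Proof.
elim: j f => // j IH f lejn.
by rewrite iterSr cyc_coface // IH ?(ltnW lejn) // -iterSr.
Qed.

Lemma hochS n f : hoch n f = bar n f + coface n n.+1 f.
Proof. by rewrite /hoch big_ord_recr. Qed.

(** The rotation lowers each coface index by one and sends e_0 to e_(n+1), so t b = e_(n+1) + b' t,
    while b = b' + e_(n+1). *)
Lemma hoch_cyc n f : hoch n f - cyc n.+1 (hoch n f) = bar n (f - cyc n f).
Proof.
have cycb : cyc n.+1 (hoch n f) = coface n n.+1 f + bar n (cyc n f).
  rewrite /hoch big_ord_recl linearD linear_sum /= cyc_coface0; congr (_ + _).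
  by apply: eq_bigr => j _; rewrite cyc_coface // -ltnS.
by rewrite cycb hochS opprD addrA addrK linearB.
Qed.

Lemma cyc_cnorm n f : cyc n (cnorm n f) = cnorm n f.
Proof.
rewrite {1}/cnorm linear_sum big_ord_recr -[X in _ + X = _]/(iter n.+1 _ _).
rewrite cyc_order /cnorm big_ord_recl addrC; congr (_ + _).
Qed.

Lemma cnorm_cyc n f : cnorm n (cyc n f) = cnorm n f.
Proof.
rewrite -[RHS]cyc_cnorm /cnorm linear_sum.
by apply: eq_bigr => i _; rewrite -iterSr.
Qed.

Lemma iter_cyc_cnorm n k f : iter k (cyc n) (cnorm n f) = cnorm n f.
Proof. by elim: k => // k IH; rewrite iterS IH cyc_cnorm. Qed.

Lemma cnorm_iter_cyc n k f : cnorm n (iter k (cyc n) f) = cnorm n f.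
Proof. by elim: k => // k IH; rewrite iterS cnorm_cyc. Qed.

(* Both sides are [N e_0 N], since the [j]-th signed coface is [e_0] conjugated
   by the [j]-th power of the rotation. *)
Lemma cnorm_bar n f : cnorm n.+1 (bar n f) = hoch n (cnorm n f).
Proof.
transitivity (cnorm n.+1 (coface n 0 (cnorm n f))).
  rewrite /bar [X in coface n 0 X]/cnorm !linear_sum; apply: eq_bigr => j _ /=.
  by rewrite -(cnorm_iter_cyc n.+1 j) iter_cyc_coface // ltnW.
rewrite -(cyc_cnorm n.+1) {1}/cnorm linear_sum /hoch.
rewrite (reindex_inj rev_ord_inj); apply: eq_bigr => j _ /=.
rewrite subSS -(iter_cyc_cnorm n j f) -iter_cyc_coface -1?ltnS // iter_cyc_cnorm.
by rewrite -iterS -iterD -subSn -1?ltnS // subnK ?cyc_order // ltnW.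
Qed.

(** A preimage under 1 - t of the elements killed by N: as t^(n+1) = 1, the sum S of the i t^i f
    satisfies (t - 1) S = (n + 1) f - N f. Dividing by n + 1 uses characteristic zero. *)
Definition cyc_primitive n f : V :=
  - (n.+1%:R^-1 *: \sum_(i < n.+1) i%:R *: iter i (cyc n) f).

Lemma cyc_primitiveP n f : cnorm n f = 0 ->
  cyc_primitive n f - cyc n (cyc_primitive n f) = f.
Proof.
move=> Nf0; rewrite /cyc_primitive; set S := \sum_(i < n.+1) _.
have SE : cyc n S - S = n.+1%:R *: f.
  have -> : cyc n S = \sum_(i < n.+1) i%:R *: iter i.+1 (cyc n) f.
    by rewrite linear_sum; apply: eq_bigr => i _; rewrite linearZ.
  rewrite big_ord_recr cyc_order /S big_ord_recl scale0r add0r.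
  rewrite addrAC -sumrB.
  under eq_bigr => i _ do rewrite -scalerBl lift0 -natr1 opprD addNKr scaleN1r.
  have Ef : \sum_(i < n) iter i.+1 (cyc n) f = - f.
    by apply/eqP; rewrite -addr_eq0 addrC -[X in _ == X]Nf0 /cnorm big_ord_recl.
  by rewrite sumrN Ef opprK -[X in X + _]scale1r -scalerDl nat1r.
by rewrite linearN opprK addrC linearZ -scalerBr SE scalerA mulVf ?scale1r ?pnatr_eq0.
Qed.

(** * Multilinearity of sequence cochains *)

Definition upd a i x : nat -> A := fun k => if k == i then x else a k.

Lemma updE a i : upd a i (a i) = a.
Proof. by apply/funext => k; rewrite /upd; case: eqP => // ->. Qed.

(** The entries after [n] are mere parameters; the dependence on them is unrestricted. *)
Definition slot_linear n f := forall i a (k : K) x y, (i <= n)%N ->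
  f (upd a i (k *: x + y)) = k * f (upd a i x) + f (upd a i y).

Lemma slot_linear_comb n k f g :
  slot_linear n f -> slot_linear n g -> slot_linear n (k *: f + g).
Proof.
move=> fl gl i a c x y lein; rewrite !fctE fl // gl // /GRing.scale /=; ring.
Qed.

Lemma slot_linear0 n : slot_linear n 0.
Proof. by move=> i a c x y _; rewrite -[RHS]/(c * 0 + 0) mulr0 addr0. Qed.

Lemma slot_linearZ n k f : slot_linear n f -> slot_linear n (k *: f).
Proof. by move=> fl; rewrite -[_ *: _]addr0; apply/slot_linear_comb/slot_linear0. Qed.

Lemma slot_linearD n f g : slot_linear n f -> slot_linear n g -> slot_linear n (f + g).
Proof. by move=> fl gl; rewrite -[f]scale1r; apply: slot_linear_comb. Qed.

Lemma slot_linearB n f g : slot_linear n f -> slot_linear n g -> slot_linear n (f - g).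
Proof. by move=> fl gl; rewrite addrC -scaleN1r; apply: slot_linear_comb. Qed.

Lemma slot_linear_sum n (I : Type) (r : seq I) (P : pred I) (F : I -> V) :
  (forall i, P i -> slot_linear n (F i)) -> slot_linear n (\sum_(i <- r | P i) F i).
Proof. by move=> Fl; apply: big_ind => //; [exact: slot_linear0|exact: slot_linearD]. Qed.

(** Common criterion for the operators above and below: changing one entry of [a] changes a single
    entry of [F a], and does so linearly. *)
Lemma slot_linear_comp n m (c : K) (F : (nat -> A) -> nat -> A) f : slot_linear n f ->
    (forall i a, (i <= m)%N -> exists j (l : A -> A),
      [/\ (j <= n)%N, linear l & forall x, F (upd a i x) = upd (F a) j (l x)]) ->
  slot_linear m (fun a => c * f (F a)).
Proof.
move=> fl FP i a k x y leim; have [j [l [lejn ll FE]]] := FP i a leim.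
by rewrite !FE ll fl //; ring.
Qed.

Lemma slot_linear_cyc n f : slot_linear n f -> slot_linear n (cyc n f).
Proof.
move=> fl; apply: slot_linear_comp fl _ => i a lein.
case: (eqVneq i n) => [->|ni]; [exists 0%N, id|exists i.+1, id];
  split=> //; try lia;
  move=> x; apply/funext => -[|k]; rewrite /srot /upd; by_slots.
Qed.

Hypotheses (mulA : associative mul) (mul1x : left_id one mul) (mulx1 : right_id one mul).
Hypotheses (mul_linl : forall z, linear (mul^~ z)) (mul_linr : forall z, linear (mul z)).

Lemma slot_linear_coface n j f :
  (j <= n.+1)%N -> slot_linear n f -> slot_linear n.+1 (coface n j f).
Proof.
move=> lejn fl; apply: slot_linear_comp fl _ => i a lein.
case: (leqP j n) => jn.
- case: (ltngtP i j) => [ltij|ltji|->].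
  + exists i, id; split=> //; first by lia.
    by move=> x; apply/funext => k; rewrite /sface jn /upd; by_slots.
  + case: (eqVneq i j.+1) => [->|ij1].
      exists j, (mul (a j)); split=> // x; apply/funext => k; rewrite /sface jn /upd.
      by_slots.
    exists i.-1, id; split=> //; first by lia.
    by move=> x; apply/funext => k; rewrite /sface jn /upd; by_slots.
  + exists j, (mul^~ (a j.+1)); split=> // x; apply/funext => k; rewrite /sface jn /upd.
    by_slots.
- have {lejn jn}-> : j = n.+1 by lia.
  rewrite /sface ltnn.
  case: (eqVneq i 0%N) => [->|i0].
    exists 0%N, (mul (a n.+1)); split=> // x; apply/funext => k; rewrite /sface /upd.
    by_slots.
  case: (eqVneq i n.+1) => [->|i1].
    exists 0%N, (mul^~ (a 0%N)); split=> // x; apply/funext => k; rewrite /sface /upd.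
    by_slots.
  exists i, id; split=> //; first by lia.
  move=> x; apply/funext => k; rewrite /sface /upd.
  by_slots.
Qed.

Lemma slot_linear_hoch n f : slot_linear n f -> slot_linear n.+1 (hoch n f).
Proof.
move=> fl; apply: slot_linear_sum => j _.
by apply: slot_linear_coface fl; have := ltn_ord j; lia.
Qed.

Lemma slot_linear_bar n f : slot_linear n f -> slot_linear n.+1 (bar n f).
Proof.
move=> fl; apply: slot_linear_sum => j _.
by apply: slot_linear_coface fl; have := ltn_ord j; lia.
Qed.

Lemma slot_linear_iter_cyc n k f : slot_linear n f -> slot_linear n (iter k (cyc n) f).
Proof. by move=> fl; elim: k => // k IH; apply: slot_linear_cyc. Qed.

Lemma slot_linear_cnorm n f : slot_linear n f -> slot_linear n (cnorm n f).
Proof. by move=> fl; apply: slot_linear_sum => j _; apply: slot_linear_iter_cyc. Qed.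

Lemma slot_linear_cyc_primitive n f :
  slot_linear n f -> slot_linear n (cyc_primitive n f).
Proof.
move=> fl; rewrite /cyc_primitive -scaleNr; apply/slot_linearZ/slot_linear_sum => i _.
exact/slot_linearZ/slot_linear_iter_cyc.
Qed.

(** * Simplicial identities and acyclicity of the bar complex *)

Lemma sface_sface n i j a : (i < j <= n.+2)%N ->
  sface n i (sface n.+1 j a) = sface n j.-1 (sface n.+1 i a).
Proof.
move=> ij; apply/funext => k; rewrite /sface.
(* Associativity enters where three cyclically adjacent entries are merged. *)
by slots; first [congr_lia | rewrite -mulA; congr_lia].
Qed.

Lemma hoch_hoch n f : hoch n.+1 (hoch n f) = 0.
Proof.
apply/funext => a; rewrite -[RHS](@alt_sum_faces _
  (fun i j => f (sface n i (sface n.+1 j a))) n.+1) => [|i j ij].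
  rewrite hochE; apply: eq_bigr => j _; rewrite hochE mulr_sumr.
  by apply: eq_bigr => i _; rewrite mulrA -exprD addnC.
by rewrite sface_sface.
Qed.

Lemma bar_bar n f : bar n.+1 (bar n f) = 0.
Proof.
apply/funext => a; rewrite -[RHS](@alt_sum_faces _
  (fun i j => f (sface n i (sface n.+1 j a))) n) => [|i j ij].
  rewrite barE; apply: eq_bigr => j _; rewrite barE mulr_sumr.
  by apply: eq_bigr => i _; rewrite mulrA -exprD addnC.
by rewrite sface_sface //; lia.
Qed.

Definition insert_one a : nat -> A := fun k => if k is k'.+1 then a k' else one.

(** Prepending the unit contracts b': face 0 of (1, a_0, a_1, ...) is the original sequence, and
    face j + 1 is face j with the unit prepended. *)
Lemma bar_contraction n f : bar n.+1 f = 0 -> f = bar n (fun a => f (insert_one a)).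
Proof.
move=> bf0; apply/funext => a; apply/eqP; rewrite -subr_eq0; apply/eqP.
transitivity (bar n.+1 f (insert_one a)); last by rewrite bf0.
rewrite [RHS]barE big_ord_recl mul1r barE -sumrN; congr (f _ + _).
  by apply/funext => -[|k]; rewrite /sface /= ?mul1x.
apply: eq_bigr => j _; rewrite lift0 exprS mulN1r mulNr.
congr (- (_ * f _)); apply/funext => -[|k]; rewrite /sface /insert_one.
  by have := ltn_ord j; by_slots.
by have := ltn_ord j; case: k => [|k]; by_slots.
Qed.

Lemma slot_linear_insert_one n f :
  slot_linear n.+1 f -> slot_linear n (fun a => f (insert_one a)).
Proof.
move=> fl i a k x y lein; have E z : insert_one (upd a i z) = upd (insert_one a) i.+1 z.
  by apply/funext => -[|m].
by rewrite !E fl.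
Qed.

(** * A simplicial homotopy from intertwining relations *)

Section Homotopy.
Variables (rho al : A -> A) (x y : A).

(* [rho(a_0) y, al(a_1), ..., al(a_i), x, rho(a_(i+1)), ..., rho(a_n)]: a homotopy
   from [rho(a_0) y x, rho(a_1), ..., rho(a_n)] to [al(a_0), ..., al(a_n)]. *)
Definition hins n i a : nat -> A := fun k =>
  if k == 0%N then mul (rho (a 0%N)) y
  else if (k <= i)%N then al (a k)
  else if k == i.+1 then x
  else if (k <= n.+1)%N then rho (a k.-1) else a k.-1.

Definition homot n f : V := \sum_(i < n.+1) (fun a => (-1) ^+ i * f (hins n i a)).

Hypotheses (rhol : linear rho) (al_lin : linear al).

Lemma slot_linear_homot n f : slot_linear n.+1 f -> slot_linear n (homot n f).
Proof.
move=> fl; apply: slot_linear_sum => i _; apply: slot_linear_comp fl _ => k a lekn.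
case: (eqVneq k 0%N) => [->|k0].
  exists 0%N, (mul^~ y \o rho); split=> // [c u w|z].
    by rewrite /= rhol mul_linl.
  apply/funext => m; rewrite /hins /upd; by_slots.
have := ltn_ord i.
case: (leqP k i) => ki; [exists k, al|exists k.+1, rho];
  split=> //; try lia; move=> z; apply/funext => m; rewrite /hins /upd; by_slots.
Qed.

Hypotheses (rhoM : forall u w, rho (mul u w) = mul (rho u) (rho w)).
Hypotheses (alM : forall u w, al (mul u w) = mul (al u) (al w)).
Hypotheses (xrho : forall u, mul x (rho u) = mul (al u) x).
Hypotheses (rhoy : forall u, mul (rho u) y = mul y (al u)).
Hypotheses (xy : mul x y = one).

Lemma rho_y_al u w : mul (mul (rho u) y) (al w) = mul (rho (mul u w)) y.
Proof. by rewrite rhoM -!mulA rhoy. Qed.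

Lemma sface_hins_lt n i j a : (j < i <= n.+1)%N ->
  sface n.+1 j (hins n.+1 i a) = hins n i.-1 (sface n j a).
Proof.
move=> ji; apply/funext => k; rewrite /sface /hins.
by slots; first [congr_lia | rewrite rho_y_al; congr_lia | rewrite -alM; congr_lia].
Qed.

Lemma sface_hins_gt n i j a : (i.+1 < j <= n.+2)%N ->
  sface n.+1 j (hins n.+1 i a) = hins n i (sface n j.-1 a).
Proof.
move=> ji; apply/funext => k; rewrite /sface /hins.
by slots; first [congr_lia | rewrite rhoM ?mulA; congr_lia].
Qed.

(** The left side merges [al (a i)] with [x], the right side merges [x] with [rho (a i)]; [xrho]
    equates the two products. *)
Lemma sface_hins_eq n i a : (0 < i <= n)%N ->
  sface n i (hins n i a) = sface n i (hins n i.-1 a).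
Proof.
move=> ji; apply/funext => k; rewrite /sface /hins.
by slots; first [congr_lia | rewrite -xrho; congr_lia].
Qed.

Definition head_twist n a : nat -> A := fun k =>
  if k == 0%N then mul (mul (rho (a 0%N)) y) x
  else if (k <= n)%N then rho (a k) else a k.

Definition image_upto n a : nat -> A := fun k => if (k <= n)%N then al (a k) else a k.

Lemma sface_hins_first n a : sface n 0 (hins n 0 a) = head_twist n a.
Proof. by apply/funext => k; rewrite /sface /hins /head_twist; by_slots. Qed.

(** The wrap-around face puts x rho(a_0) y = x y al(a_0) = al(a_0) in slot 0. *)
Lemma sface_hins_last n a : sface n n.+1 (hins n n a) = image_upto n a.
Proof.
apply/funext => k; rewrite /sface /hins /image_upto.
by slots; first [congr_lia | rewrite rhoy mulA xy mul1x; congr_lia].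
Qed.

Lemma homotE n f a : homot n f a = \sum_(i < n.+1) (-1) ^+ i * f (hins n i a).
Proof. by rewrite /homot fct_sumE. Qed.

(** All terms cancel as in [alt_sum_homotopy] except the first face of the first insertion and the
    wrap-around face of the last one. *)
Lemma homot_hoch n f a :
  homot n (hoch n f) a + (if n is m.+1 then hoch m (homot m f) a else 0) =
  f (head_twist n a) - f (image_upto n a).
Proof.
rewrite -sface_hins_first -sface_hins_last.
(* In degree 0 the value of [n.-1] is harmless, since the double sum over [F] is empty. *)
rewrite -(@alt_sum_homotopy _ (fun i j => f (sface n j (hins n i a)))
  (fun i j => f (hins n.-1 i (sface n.-1 j a)))); first last.
- by move=> i ij; rewrite sface_hins_eq.
- by case: n => [|n] i j ij; [lia|rewrite sface_hins_gt].
- by case: n => [|n] i j ij; [lia|rewrite sface_hins_lt].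
congr (_ + _).
  rewrite homotE; apply: eq_bigr => i _; rewrite hochE mulr_sumr.
  by apply: eq_bigr => j _; rewrite mulrA -exprD.
case: n => [|n]; first by rewrite big_ord0.
rewrite exchange_big hochE; apply: eq_bigr => j _; rewrite homotE mulr_sumr.
by apply: eq_bigr => i _; rewrite mulrA -exprD addnC.
Qed.

End Homotopy.

(** * Vanishing of Hochschild cohomology, then of cyclic cohomology *)

Section Vanishing.
Variables (rho : A -> A) (v vb s sb : A).
Hypotheses (rhol : linear rho).
Hypotheses (rhoM : forall u w, rho (mul u w) = mul (rho u) (rho w)).
Hypotheses (rhov : forall u, mul (rho u) v = mul v u).
Hypotheses (vbrho : forall u, mul vb (rho u) = mul u vb).
Hypotheses (rhos : forall u, mul (rho u) s = mul s (rho u)).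
Hypotheses (sbrho : forall u, mul sb (rho u) = mul (rho u) sb).
Hypotheses (vbv : mul vb v = one) (sbs : mul sb s = one).
Hypotheses (vvb : mul v vb + mul s sb = one).

(* The homotopies for [(vb, v)] and [(sb, s)] end at [id] and at [rho], and their
   origins add up to [rho] since [v vb + s sb = 1]: the two [rho] terms cancel. *)
Lemma hoch_acyclic n f : slot_linear n f -> hoch n f = 0 ->
  if n is m.+1 then exists2 g, slot_linear m g & hoch m g = f else f = 0.
Proof.
move=> fl bf0.
have key a : (if n is m.+1 then
    hoch m (homot rho id vb v m f) a + hoch m (homot rho rho sb s m f) a
    else 0) = - f a.
  have := @homot_hoch rho id vb v rhoM (fun _ _ => erefl) vbrho rhov vbv n f a.
  have := @homot_hoch rho rho sb s rhoM rhoM sbrho rhos sbs n f a.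
  have zeroE rh al x y b : homot rh al x y n (0 : V) b = 0.
    by rewrite homotE big1 // => i _; rewrite mulr0.
  rewrite bf0 !zeroE !add0r => E1 E2.
  pose b := head_twist rho vb v n a; pose b' := head_twist rho sb s n a.
  pose c := image_upto rho n a.
  have idE : image_upto id n a = a.
    by apply/funext => k; rewrite /image_upto; case: ifP.
  have rho_dist w t u : mul w (t + u) = mul w t + mul w u.
    by have := mul_linr w 1 t u; rewrite !scale1r.
  (* The sequences [c], [b], [b'] differ only in entry 0, where rho(a_0) is split along 1 = v vb + s
     sb. *)
  have split_c : f c = f b + f b'.
    have -> : c = upd c 0 (1 *: mul (rho (a 0%N)) (mul v vb)
                           + mul (rho (a 0%N)) (mul s sb)).
      by rewrite scale1r -(rho_dist _ _ _) vvb mulx1 updE.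
    rewrite fl // mul1r; congr (f _ + f _); apply/funext => k;
      by rewrite mulA /upd /b /b' /head_twist /c /image_upto; slots.
  transitivity ((f b - f a) + (f b' - f c)); last by rewrite split_c; ring.
  rewrite idE in E2; rewrite -[f b - f a]E2 -[f b' - f c]E1.
  by case: (n) => [|m]; rewrite ?addr0.
case: n fl bf0 key => [|n] fl bf0 key.
  by apply/funext => a; apply/eqP; rewrite -oppr_eq0 -key.
exists (- (homot rho id vb v n f + homot rho rho sb s n f)).
  rewrite -scaleN1r; apply/slot_linearZ/slot_linearD; exact: slot_linear_homot.
by apply/funext => a; rewrite linearN linearD -[LHS]/(- (_ + _)) key opprK.
Qed.

(** Strong induction descending by two degrees; degrees 0 and 1 follow directly from
    [hoch_acyclic]. *)
Lemma cyclic_acyclic n f : slot_linear n f -> cyc n f = f -> hoch n f = 0 ->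
  if n is m.+1 then exists g, [/\ slot_linear m g, cyc m g = g & hoch m g = f] else f = 0.
Proof.
elim/ltn_ind: n f => -[|[|n]] IH f fl fc bf0.
- exact: hoch_acyclic fl bf0.
- have [g gl gb] := hoch_acyclic fl bf0; exists g; split=> //.
  (* In degree 0 the rotation is the identity, so every cochain is cyclic. *)
  exact: (cyc_order 0).
have [g gl gb] := hoch_acyclic fl bf0.
pose chi := g - cyc n.+1 g.
have bchi : bar n.+1 chi = 0 by rewrite -hoch_cyc gb fc subrr.
have chil : slot_linear n.+1 chi by apply/slot_linearB/slot_linear_cyc.
pose theta : V := fun a => chi (insert_one a).
have thetal : slot_linear n theta by exact: slot_linear_insert_one.
have btheta : bar n theta = chi by rewrite -(bar_contraction bchi).
(* b N theta = N b' theta = N (1 - t) g = 0. *)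
have Nb : hoch n (cnorm n theta) = 0.
  by rewrite -cnorm_bar btheta /chi linearB /= cnorm_cyc subrr.
have [k kl kb] : exists2 k, slot_linear n k & bar n (k - cyc n k) = chi.
  have [th' [thl' bth' Nth']] :
      exists th, [/\ slot_linear n th, bar n th = chi & cnorm n th = 0].
    have := IH n (ltnW (ltnSn _)) _ (slot_linear_cnorm thetal) (cyc_cnorm _ _) Nb.
    move: theta thetal btheta {Nb} => theta thetal btheta.
    case: n {IH fl fc bf0 gl gb} chi bchi chil theta thetal btheta
      => [|n] chi bchi chil theta thetal btheta.
      by move=> N0; exists theta.
    move=> [eta [etal etac etab]].
    have Neta : cnorm n eta = n.+1%:R *: eta.
      have it i : iter i (cyc n) eta = eta by elim: i => // i IHi; rewrite iterS IHi.
      rewrite /cnorm; under eq_bigr => i _ do rewrite it.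
      by rewrite sumr_const card_ord scaler_nat.
    (* The correction does not affect b' theta, and N b' eta = b N eta = (n + 1) b eta = (n + 1) N
       theta, so the norm becomes 0. *)
    exists (theta - n.+1%:R^-1 *: bar n eta); split.
    - exact/slot_linearB/slot_linearZ/slot_linear_bar.
    - by rewrite linearB linearZ /= bar_bar // scaler0 subr0.
    - rewrite linearB linearZ /= cnorm_bar Neta -etab [X in _ - _ *: X]linearZ scalerA.
      by rewrite mulVf ?scale1r ?subrr // pnatr_eq0.
  exists (cyc_primitive n th'); first exact: slot_linear_cyc_primitive.
  by rewrite cyc_primitiveP.
(* Cyclic because (1 - t) b k = b' (1 - t) k = chi = (1 - t) g. *)
exists (g - hoch n k); split; first exact/slot_linearB/slot_linear_hoch.
- have cg : cyc n.+1 g = g - chi by rewrite subKr.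
  have ck : cyc n.+1 (hoch n k) = hoch n k - chi.
    by rewrite -kb -hoch_cyc subKr.
  have cancel (x y z : V) : (x - z) - (y - z) = x - y by rewrite opprB addrA subrK.
  by rewrite linearB /= cg ck cancel.
- by rewrite linearB /= hoch_hoch // subr0.
Qed.

End Vanishing.
End SequenceCochains.

(** * Passage between cochains on finite tuples and on sequences *)

Section Transfer.
Variables (K : numFieldType) (A : lmodType K) (mul : A -> A -> A).
Local Notation V := ((nat -> A) -> K^o).

Definition to_seq n (phi : cochain A n) : V := fun a => phi (fun i => a i).

(** Past the last entry a face only shifts the sequence, so padding by 0 is stable under faces and
    [of_seq] commutes with b. *)
Definition extend n (a : 'I_n.+1 -> A) : nat -> A := fun k => oapp a 0 (insub k).

Definition of_seq n (g : V) : cochain A n := fun a => g (extend a).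

Lemma extendE n (a : 'I_n.+1 -> A) (i : 'I_n.+1) : extend a i = a i.
Proof. by rewrite /extend valK. Qed.

Lemma extend_in n (a : 'I_n.+1 -> A) k (ltkn : (k < n.+1)%N) :
  extend a k = a (Ordinal ltkn).
Proof. exact: (extendE a (Ordinal ltkn)). Qed.

Lemma extend_out n (a : 'I_n.+1 -> A) k : (n < k)%N -> extend a k = 0.
Proof. by move=> ltnk; rewrite /extend insubN // -leqNgt. Qed.

Lemma extend_ext n (a : 'I_n.+1 -> A) (b : nat -> A) :
  (forall i : 'I_n.+1, b i = a i) -> (forall k, (n < k)%N -> b k = 0) -> extend a = b.
Proof.
move=> ba b0; apply/funext => k; case: (ltnP k n.+1) => kn.
  by rewrite extend_in -ba.
by rewrite extend_out ?b0.
Qed.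

Lemma to_seqK n : cancel (@to_seq n) (@of_seq n).
Proof.
move=> phi; apply/funext => a; rewrite /of_seq /to_seq; congr phi.
by apply/funext => i; rewrite extendE.
Qed.

Lemma face_seq n (a : nat -> A) (j : 'I_n.+1) :
  face mul (fun i : 'I_n.+2 => a i) j = (fun i : 'I_n.+1 => sface mul n j a i).
Proof.
apply/funext => i; rewrite /face /sface leq_ord lift0 lift_max.
by rewrite -[i == j]/(val i == val j).
Qed.

Lemma last_face_seq n (a : nat -> A) :
  last_face mul (fun i : 'I_n.+2 => a i) = (fun i : 'I_n.+1 => sface mul n n.+1 a i).
Proof.
apply/funext => i; rewrite /last_face /sface ltnn lift_max leq_ord.
by rewrite -[i == _]/(val i == 0%N).
Qed.

Lemma face_extend n (a : 'I_n.+2 -> A) (j : 'I_n.+1) :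
  extend (face mul a j) = sface mul n j (extend a).
Proof.
rewrite (_ : a = fun i : 'I_n.+2 => extend a i); last first.
  by apply/funext => i; rewrite extendE.
rewrite face_seq; apply: extend_ext => [i|k ltnk].
  by congr (sface mul n j _ _); apply: extend_ext => // k; apply: extend_out.
rewrite /sface leq_ord; have := ltn_ord j.
case: ifP => [|_]; first by lia.
by case: ifP => [|_]; [lia|rewrite extend_out].
Qed.

Lemma last_face_extend n (a : 'I_n.+2 -> A) :
  extend (last_face mul a) = sface mul n n.+1 (extend a).
Proof.
rewrite (_ : a = fun i : 'I_n.+2 => extend a i); last first.
  by apply/funext => i; rewrite extendE.
rewrite last_face_seq; apply: extend_ext => [i|k ltnk].
  by congr (sface mul n n.+1 _ _); apply: extend_ext => // k; apply: extend_out.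
rewrite /sface ltnn; case: ifP => [|_]; first by lia.
by case: ifP => [|_]; [lia|rewrite extend_out].
Qed.

Lemma hoch_to_seq n (phi : cochain A n) :
  hoch mul n (to_seq phi) = to_seq (hochschild mul phi).
Proof.
apply/funext => a; rewrite hochE big_ord_recr /to_seq /hochschild /=.
rewrite last_face_seq; congr (_ + _).
by apply: eq_bigr => j _; rewrite face_seq.
Qed.

Lemma hochschild_of_seq n (g : V) :
  hochschild mul (@of_seq n g) = of_seq (hoch mul n g).
Proof.
apply/funext => a; rewrite {2}/of_seq hochE big_ord_recr /= /hochschild.
rewrite {2}/of_seq last_face_extend; congr (_ + _).
by apply: eq_bigr => j _; rewrite /of_seq face_extend.
Qed.

Lemma dfwith_seq n (a : nat -> A) (i : 'I_n.+1) x :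
  (fun j : 'I_n.+1 => upd a i x j) = dfwith (fun j : 'I_n.+1 => a j) i x.
Proof.
apply/funext => j; rewrite /upd -[val j == val i]/(j == i).
by case: dfwithP => [|k ik]; [rewrite eqxx|rewrite eq_sym (negPf ik)].
Qed.

Lemma extend_dfwith n (a : 'I_n.+1 -> A) i x :
  extend (dfwith a i x) = upd (extend a) i x.
Proof.
apply: extend_ext => [j|k ltnk].
  rewrite /upd -[val j == val i]/(j == i).
  by case: dfwithP => [|k ik]; [rewrite eqxx|rewrite eq_sym (negPf ik) extendE].
by rewrite /upd extend_out //; case: eqP => // ki; have := ltn_ord i; lia.
Qed.

Lemma slot_linear_to_seq n (phi : cochain A n) :
  multilinear phi -> slot_linear n (to_seq phi).
Proof.
move=> phil i a k x y lein; rewrite /to_seq.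
by have := dfwith_seq a (Ordinal (lein : (i < n.+1)%N)) => /= E; rewrite !E phil.
Qed.

Lemma multilinear_of_seq n (g : V) : slot_linear n g -> multilinear (@of_seq n g).
Proof.
by move=> gl i a k x y; rewrite /of_seq !extend_dfwith gl // -ltnS.
Qed.

(** The two cyclicity conditions rotate in opposite directions: the index shift [ordS] undoes
    [srot]. *)
Lemma cyc_to_seq n (phi : cochain A n) :
  (forall a, phi (fun i => a (ordS i)) = (-1) ^+ n * phi a) ->
  cyc n (to_seq phi) = to_seq phi.
Proof.
move=> phic; apply/funext => a; rewrite /cyc /to_seq -phic; congr phi.
apply/funext => i; rewrite /srot /=; have := ltn_ord i.
case: (eqVneq (val i) n) => /= [->|ni] ltin; first by rewrite modnn.
by rewrite modn_small //=; [case: ifP => //; lia|lia].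
Qed.

Lemma cyclic_of_seq n (g : V) : cyc n g = g ->
  forall a, @of_seq n g (fun i => a (ordS i)) = (-1) ^+ n * @of_seq n g a.
Proof.
move=> gc a; rewrite /of_seq -{1}gc /cyc; congr (_ * g _).
apply/funext => k; rewrite /srot; case: (ltnP n k) => [ltnk|lekn].
  by rewrite (gtn_eqF (leq_ltn_trans _ ltnk)) // !extend_out.
case: eqP => [k0|k0].
  rewrite !extend_in; congr a; apply: val_inj; by rewrite /= k0 modnn.
have ltk : (k.-1 < n.+1)%N by lia.
rewrite !extend_in; congr a; apply: val_inj; rewrite /= modn_small; lia.
Qed.

(** A class is zero once its representative is a coboundary. The representative is read as a
    sequence cochain, and its primitive is brought back by [of_seq]. *)
Lemma cyclic_cohomology_trivial n :
    (forall f, slot_linear n f -> cyc n f = f -> hoch mul n f = 0 ->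
      if n is m.+1 then exists g, [/\ slot_linear m g, cyc m g = g & hoch mul m g = f]
      else f = 0) ->
  forall x : cyclic_cohomology mul n, x = 0.
Proof.
move=> acyclic x; rewrite -[x]reprK; set phi := repr x.
apply/eqP; rewrite piE Quotient.equivE subr0.
have /andP[/asboolP[phil phic] /asboolP phib] := cocycleP phi.
have := acyclic _ (slot_linear_to_seq phil) (cyc_to_seq phic).
rewrite hoch_to_seq phib => /(_ erefl).
case: n {acyclic x} phi phil phic phib => [|m] phi phil phic phib.
  move=> phi0; apply/eqP/val_inj; rewrite /= -[LHS](to_seqK phi) phi0.
  by apply/funext.
move=> [g [gl gc gb]]; apply/asboolP; exists (of_seq g).
  by apply/asboolP; split; [exact: multilinear_of_seq|exact: cyclic_of_seq].
by rewrite hochschild_of_seq gb to_seqK.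
Qed.

End Transfer.

Local Open Scope classical_set_scope.

(** * Strongly convergent series of operators with orthogonal ranges *)

Section Operators.
Variables (R : realType) (H : completeNormedModType R[i]).
Variables (dot : {dot H for Num.conj}) (A : vonNeumannAlgebra dot).
Hypothesis normE : forall x : H, `|x| ^+ 2 = dot x x.

Lemma vn_linear_val (f : vn_elt A) : linear f.
Proof. by have [] := vn_eltB f. Qed.
HB.instance Definition _ (f : vn_elt A) :=
  GRing.isLinear.Build R[i] H H *:%R f (vn_linear_val f).

Lemma vn_sumE (I : Type) (r : seq I) (P : pred I) (F : I -> vn_elt A) x :
  (\sum_(i <- r | P i) F i) x = \sum_(i <- r | P i) F i x.
Proof. by elim/big_rec2: _ => // i y f _ <-. Qed.

(** The bound in [bounded_operator] is just a complex number. A nonzero vector forces it to be real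
    and nonnegative, and adding 1 makes it positive; on the zero space 1 serves. *)
Lemma vn_lipschitz (f : vn_elt A) :
  exists2 M : R[i], 0 < M & forall x, `|f x| <= M * `|x|.
Proof.
have [_ [M fM]] := vn_eltB f.
have [[x x0]|/forallNP H0] := pselect (exists x : H, x != 0).
  have M0 : 0 <= M.
    rewrite -(pmulr_lge0 _ (_ : 0 < `|x|)) ?normr_gt0 //.
    exact: le_trans (fM x).
  exists (M + 1); first by rewrite ltr_wpDl.
  by move=> y; rewrite mulrDl mul1r (le_trans (fM y)) // lerDl.
exists 1 => // x; have /negP := H0 x; rewrite negbK => /eqP ->.
by rewrite linear0 normr0 mulr0.
Qed.

Lemma dot_sum_orthogonal (z : nat -> H) m n k :
    (forall i j, i != j -> dot (z i) (z j) = 0) -> (n <= k)%N ->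
  dot (\sum_(m <= i < n) z i) (z k) = 0.
Proof.
move=> oz lenk; rewrite linear_sumlz big_nat big1 // => i /andP[_ lin].
by apply: oz; rewrite neq_ltn (leq_trans lin).
Qed.

Lemma pythagoras (z : nat -> H) m n : (forall i j, i != j -> dot (z i) (z j) = 0) ->
  `|\sum_(m <= i < n) z i| ^+ 2 = \sum_(m <= i < n) `|z i| ^+ 2.
Proof.
move=> oz; elim: n => [|n IH]; first by rewrite !big_geq // normr0 expr0n.
case: (leqP m n) => mn; last by rewrite !big_geq // normr0 expr0n.
rewrite !big_nat_recr //= -IH !normE; apply: hnormDd.
exact: dot_sum_orthogonal.
Qed.

Lemma ler_norm_orthogonal_sum (M : R[i]) (z w : nat -> H) m n : 0 <= M ->
    (forall i j, i != j -> dot (z i) (z j) = 0) ->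
    (forall i j, i != j -> dot (w i) (w j) = 0) ->
    (forall i, `|w i| <= M * `|z i|) ->
  `|\sum_(m <= i < n) w i| <= M * `|\sum_(m <= i < n) z i|.
Proof.
move=> M0 oz ow wz; rewrite -(@ler_pXn2r _ 2) ?nnegrE ?mulr_ge0 //.
rewrite exprMn !pythagoras // mulr_sumr ler_sum // => i _.
by rewrite -exprMn lerXn2r ?nnegrE ?mulr_ge0.
Qed.

Section Swindle.
Variables (v vs : nat -> vn_elt A).
Hypotheses (vadj : forall i, is_adjoint dot (v i) (vs i)).
Hypotheses (vsv : forall i j, vs i * v j = (i == j)%:R).
Hypotheses (sum_v : forall x, \sum_(i < n) v i (vs i x) @[n --> \oo] --> x).

Lemma vsvE i j x : vs i (v j x) = if i == j then x else 0.
Proof.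
rewrite -[LHS]/((vs i * v j) x) vsv; by case: eqP.
Qed.

Lemma v_isometry i x : `|v i x| = `|x|.
Proof.
by apply/eqP; rewrite -(@eqrXn2 _ 2) // !normE vadj vsvE eqxx.
Qed.

Lemma v_orthogonal i j x y : i != j -> dot (v i x) (v j y) = 0.
Proof. by move=> ij; rewrite vadj vsvE (negPf ij) linear0r. Qed.

(** The difference kills the range of every v_j, hence the partial sums of the v_i v_i^* x; these
    tend to x and the difference is bounded. *)
Lemma vn_ext (f g : vn_elt A) : (forall j, f * v j = g * v j) -> f = g.
Proof.
move=> fg; have [d dE] : exists d : vn_elt A, d = f - g by exists (f - g).
apply/eqP; rewrite -subr_eq0 -dE; apply/eqP.
have dv j x : d (v j x) = 0.
  by rewrite -[LHS]/((d * v j) x) dE mulrBl fg subrr.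
have [M M0 dM] := vn_lipschitz d.
suff dx x : d x = 0 by apply/val_inj/funext.
apply/eqP; rewrite -normr_le0.
apply/ler_addgt0Pr => e e0; rewrite add0r.
have /cvgrPdist_lt/(_ (e / M)) := @sum_v x.
rewrite divr_gt0 // => /(_ isT)[N _ /(_ N (leqnn N))] /= xN.
rewrite (_ : d x = d (x - \sum_(i < N) v i (vs i x))); last first.
  by rewrite linearB linear_sum big1 ?subr0 // => i _; exact: dv.
by rewrite (le_trans (dM _)) // -ler_pdivlMl // mulrC ltW.
Qed.

(** The operator is the strong sum of the w_i v_i^*. By orthogonality its blocks are at most M times
    those of the convergent series of the v_i v_i^* x, so its partial sums are Cauchy. *)
Lemma orthogonal_series (w : nat -> vn_elt A) (M : R[i]) : 0 < M ->
    (forall j x, `|w j x| <= M * `|x|) ->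
    (forall i j x y, i != j -> dot (w i x) (w j y) = 0) ->
  exists g : vn_elt A, forall j, g * v j = w j.
Proof.
move=> M0 wM ow; pose S n : vn_elt A := \sum_(i < n) w i * vs i.
have SE n x : S n x = \sum_(i < n) w i (vs i x) by rewrite vn_sumE.
have sum_bound m n x : `|\sum_(m <= i < n) w i (vs i x)| <=
    M * `|\sum_(m <= i < n) v i (vs i x)|.
  apply: (@ler_norm_orthogonal_sum M (fun i => v i (vs i x)) (fun i => w i (vs i x))
      _ _ (ltW M0)) => [i j|i j|i].
  - exact: v_orthogonal.
  - exact: ow.
  - by rewrite v_isometry.
have S_cvg x : cvg (S n x @[n --> \oo]).
  apply/cauchy_cvgP/cauchyP => e e0.
  have /cvgrPdist_lt/(_ (e / M / 2)) := @sum_v x.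
  rewrite !divr_gt0 // => /(_ isT)[N _ PN].
  exists (S N x); exists N => // n /= leNn.
  rewrite -ball_normE /ball_ /= distrC !SE.
  have subE (u : nat -> H) :
      \sum_(i < n) u i - \sum_(i < N) u i = \sum_(N <= i < n) u i.
    by rewrite -!(big_mkord xpredT) (big_cat_nat (leq0n N) leNn) /= addrAC subrr add0r.
  have bnd := sum_bound N n x; rewrite -!subE in bnd.
  apply: le_lt_trans bnd _.
  rewrite -ltr_pdivlMl // mulrC [ltRHS]splitr.
  apply: le_lt_trans (ltrD (PN _ leNn) (PN _ (leqnn N))).
  by rewrite [X in _ <= X + _]distrC ler_distD.
pose g x := lim (S n x @[n --> \oo]).
have Sg x : S n x @[n --> \oo] --> g x by exact: S_cvg.
have g_lin : linear g.
  move=> k x y; apply: cvg_lim => //.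
  under eq_fun do rewrite linearP.
  by apply: cvgD; [apply: cvgZr|]; exact: Sg.
have g_bd : bounded_operator g.
  split=> //; exists M => x; apply/ler_addgt0Pr => e e0.
  have M1 : 0 < M + 1 by rewrite ltr_wpDl // ltW.
  (* The error occurs once in approximating g x and M times in approximating x, in total e. *)
  have d0 : 0 < e / (M + 1) by rewrite divr_gt0.
  have /cvgrPdist_lt/(_ _ d0)[N1 _ near1] := @Sg x.
  have /cvgrPdist_lt/(_ _ d0)[N2 _ near2] := @sum_v x.
  have /ltW {near1} := near1 (maxn N1 N2) (leq_maxl _ _).
  have /ltW {near2} := near2 (maxn N1 N2) (leq_maxr _ _).
  move: (maxn N1 N2) => n Pn gn.
  have Sn : `|S n x| <= M * `|\sum_(i < n) v i (vs i x)|.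
    by rewrite SE; have := sum_bound 0%N n x; rewrite !big_mkord.
  have le1 : `|g x| <= e / (M + 1) + `|S n x|.
    by rewrite -lerBlDr (le_trans (lerB_dist _ _)).
  have le2 : `|\sum_(i < n) v i (vs i x)| <= `|x| + e / (M + 1).
    by rewrite -lerBlDl (le_trans (lerB_dist _ _)) // distrC.
  rewrite (le_trans le1) // (le_trans (lerD (lexx _) Sn)) //.
  rewrite (le_trans (lerD (lexx _) (ler_wpM2l (ltW M0) le2))) //.
  rewrite mulrDr addrCA lerD2l -{1}(mul1r (e / _)) -mulrDl (addrC 1 M) mulrC divfK //.
  by rewrite gt_eqF.
have Ag : vn_set A g.
  (* Strong closedness is applied to the image filter of the partial sums, which lie in the algebra
     and converge pointwise to [g]. *)
  apply: (vn_closed g_bd); rewrite closureEcvg.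
  exists ((fun n => S n : {ptws H -> H}) @ \oo).
    exact: fmap_proper_filter.
  split; last first.
    by move=> B AB; exists 0%N => // n _; apply: AB; exact/asboolP/vn_valP.
  by apply/(pointwise_cvgP _ _) => x; exact: Sg.
exists (VnElt (introT (asboolP _) Ag : g \in vn_pred A)) => j.
apply/val_inj/funext => x; rewrite -[LHS]/(g (v j x)).
(* From n = j + 1 on, the partial sums at v_j x are constantly w_j x. *)
apply: cvg_lim => //; apply: cvg_near_cst; exists j.+1 => // n /= ltjn.
rewrite SE (bigD1 (Ordinal ltjn)) //= vsvE eqxx big1 ?addr0 // => i ij.
by rewrite vsvE -[i == j :> nat]/(i == Ordinal ltjn) (negPf ij) linear0.
Qed.

End Swindle.
End Operators.

(** * The absorbing endomorphism of an infinite algebra *)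

Section InfiniteAlgebra.
Variables (R : realType) (H : completeNormedModType R[i]).
Variables (dot : {dot H for Num.conj}) (A : vonNeumannAlgebra dot).
Hypothesis normE : forall x : H, `|x| ^+ 2 = dot x x.

Lemma vn_mul_linearl (h : vn_elt A) : linear (fun g : vn_elt A => g * h : vn_elt A).
Proof. by move=> k f g; apply/val_inj/funext => x. Qed.

Lemma vn_mul_linearr (h : vn_elt A) : linear (fun g : vn_elt A => h * g : vn_elt A).
Proof.
move=> k f g; apply/val_inj/funext => x; rewrite -[LHS]/(h (k *: f x + g x)).
by rewrite linearP.
Qed.

Lemma infinite_vn_isometries : infinite_vn A -> exists v vs : nat -> vn_elt A,
  [/\ forall i, is_adjoint dot (v i) (vs i),
      forall i j, vs i * v j = (i == j)%:R
    & forall x : H, \sum_(i < n) v i (vs i x) @[n --> \oo] --> x].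
Proof.
move=> [p [_ orth_p equiv_p sum_p]].
have [v vP] := choice equiv_p.
exists v, (fun i => star (v i)); split=> [i|i j|x].
- exact: starP.
- case: eqP => [<-|/eqP ij]; first by case: (vP i).
  have [[svi pi] [svj pj]] := (vP i, vP j).
  (* For i != j, v_i^* v_j = v_i^* p_i p_j v_j, and the middle product is 0. *)
  have -> : star (v i) = star (v i) * p i by rewrite -pi mulrA svi mul1r.
  have -> : v j = p j * v j by rewrite -pj -mulrA svj mulr1.
  by rewrite mulrA -(mulrA _ (p i)) orth_p // mulr0 mul0r.
- have FP := fmap_filter (fun N => vn_val (\sum_(n < N) p n)) (F := \oo).
  have cv := (pointwise_cvgP _ (FP _)).1 sum_p x.
  rewrite [X in X @ _ --> _](_ : _ = fun N => vn_val (\sum_(n < N) p n) x).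
    exact: cv.
  apply/funext => n; rewrite vn_sumE; apply: eq_bigr => i _.
  by have [_ <-] := vP i.
Qed.

(** Each operator is a series prescribed by its products with the v_j, and by [ext] each identity
    need only be checked after right multiplication by every v_j. *)
Lemma absorbing_isometries : infinite_vn A ->
  exists (rho : vn_elt A -> vn_elt A) (v vb s sb : vn_elt A),
  [/\ linear rho, {morph rho : a b / a * b},
      (forall a, rho a * v = v * a) /\ (forall a, vb * rho a = a * vb),
      (forall a, rho a * s = s * rho a) /\ (forall a, sb * rho a = rho a * sb)
    & [/\ vb * v = 1, sb * s = 1 & v * vb + s * sb = 1]].
Proof.
move=> /infinite_vn_isometries [v [vs [vadj vsv sum_v]]].
have ext := vn_ext sum_v.
have series := orthogonal_series normE vadj vsv sum_v.
have orth := v_orthogonal vadj vsv.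
have iso := v_isometry normE vadj vsv.
have rho_ex a : exists g : vn_elt A, forall j, g * v j = v j * a.
  have [M M0 aM] := vn_lipschitz a.
  by apply: (series _ M) => // [j x|i j x y ij]; [rewrite iso|exact: orth].
have [s sv] : exists g : vn_elt A, forall j, g * v j = v j.+1.
  by apply: (series _ 1) => // [j x|i j x y ij]; [rewrite iso mul1r|exact: orth].
(* The backward shift, in the role of s^*: it takes v_(j+1) to v_j and kills v_0. *)
have [sb sbv] : exists g : vn_elt A, forall j, g * v j = if j is j'.+1 then v j' else 0.
  apply: (series _ 1) => // [[|j] x|[|i] [|j] x y ij]; rewrite ?mul1r.
  - by rewrite normr0.
  - by rewrite iso.
  - by [].
  - exact: linear0l.
  - exact: linear0r.
  - exact: orth.
have [rho rhov] := choice rho_ex.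
exists rho, (v 0%N), (vs 0%N), s, sb; split.
- move=> k a b; apply: ext => j.
  by rewrite rhov [in RHS]vn_mul_linearl !rhov vn_mul_linearr.
- by move=> a b; apply: ext => j; rewrite -mulrA !rhov !mulrA rhov.
- split=> a; first exact: rhov.
  apply: ext => j; rewrite -!mulrA rhov mulrA !vsv.
  by case: eqP; rewrite ?mul1r ?mulr1 ?mul0r ?mulr0.
- split=> a; apply: ext => j; rewrite -!mulrA ?sv ?sbv ?rhov.
  + by rewrite mulrA sv.
  + by case: j => [|j]; rewrite mulrA sbv ?mul0r ?mulr0.
split; first by rewrite vsv.
- by apply: ext => j; rewrite -mulrA sv sbv mul1r.
(* On v_0 only v vb contributes, on v_(j+1) only s sb. *)
apply: ext => j; rewrite mulrDl -!mulrA vsv sbv mul1r.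
by case: j => [|j] /=; rewrite ?mulr1 ?mulr0 ?addr0 ?add0r.
Qed.

End InfiniteAlgebra.

(** [normE] says that the norm of [H] comes from [dot], so that [H] is a Hilbert space. *)
Theorem proposition1 (R : realType) (H : completeNormedModType R[i])
    (dot : {dot H for Num.conj})
    (normE : forall x : H, `|x| ^+ 2 = dot x x)
    (A : vonNeumannAlgebra dot) (Ainf : infinite_vn A) (n : nat) :
  forall x : vn_cyclic_cohomology A n, x = 0.
Proof.
have [rho [v [vb [s [sb [rhol rhoM [rhov vbrho] [rhos sbrho] [vbv sbs vvb]]]]]]] :=
  absorbing_isometries normE Ainf.
apply: cyclic_cohomology_trivial => f fl fc bf0.
exact: (@cyclic_acyclic _ (vn_elt A) *%R 1 (@mulrA _) (@mul1r _) (@mulr1 _)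
  (@vn_mul_linearl _ _ _ A) (@vn_mul_linearr _ _ _ A) rho v vb s sb
  rhol rhoM rhov vbrho rhos sbrho vbv sbs vvb n f fl fc bf0).
Qed.
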